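(* Let $n\geq 3$ be an odd integer and let $a$ be an integer with $\gcd(a,n)=1$. For $x\in\mathbb{Z}$ let $\{x\}_n$ denote the least nonnegative residue of $x$ modulo $n$. Define the map $\gamma_{a,n}$ on $\{1,2,\ldots,(n-1)/2\}$ by $$\gamma_{a,n}(x)=\begin{cases} n-\{ax\}_n & \text{if } \{ax\}_n\geq (n+1)/2,\\ \{ax\}_n & \text{if } \{ax\}_n\leq (n-1)/2.\end{cases}$$ Then $\gamma_{a,n}$ is a permutation of $\{1,\ldots,(n-1)/2\}$ and its sign satisfies $$\operatorname{sign}(\gamma_{a,n})=\begin{cases}\left(\frac{a}{n}\right) & \text{if } n\equiv 1\pmod 4,\\ 1 & \text{if } n\equiv 3\pmod 4,\end{cases}$$ where $\left(\frac{a}{n}\right)$ is the Jacobi symbol.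
   Context: $\operatorname{sign}(\sigma)$ denotes the sign ($\pm1$) of a permutation $\sigma$ of a finite set. *)

(* Defs.v *)
From HB Require Import structures.
From mathcomp Require Import all_boot all_order all_algebra all_fingroup.

Set Implicit Arguments.
Unset Strict Implicit.
Unset Printing Implicit Defensive.

Import Order.TTheory GRing.Theory Num.Theory.
Local Open Scope ring_scope.

(* Only meaningful for p an odd prime. *)
Definition legendre (a : int) (p : nat) : int :=
  if (p%:Z %| a)%Z then 0
  else if [exists x : 'I_p, ((x : nat)%:Z ^+ 2 == a %[mod p%:Z])%Z] then 1
  else -1.

(* Only meaningful for n odd and positive. *)
Definition jacobi (a : int) (n : nat) : int :=
  \prod_(p <- primes n) legendre a p ^+ logn p n.

(* The finite set {1, 2, ..., (n - 1) / 2}; all its elements are below n. *)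
Definition half_range (n : nat) : finType :=
  {x : 'I_n | (1 <= x <= (n - 1) %/ 2)%N}.

Definition half_val (n : nat) (x : half_range n) : nat := val (val x).

(* intdiv's %% returns the least nonnegative residue, also for negative a. *)
Definition gamma (a : int) (n x : nat) : int :=
  let r := ((a * x%:Z) %% n%:Z)%Z in
  if ((n + 1) %/ 2)%N%:Z <= r then n%:Z - r else r.

(* Main.v *)
Require Import Defs.
From HB Require Import structures.
From mathcomp Require Import all_boot all_order all_algebra all_fingroup.
From mathcomp Require Import ring zify.

Set Implicit Arguments.
Unset Strict Implicit.
Unset Printing Implicit Defensive.

Import Order.TTheory GRing.Theory Num.Theory.
Local Open Scope ring_scope.

(** Let [s] be a half-system of a finite commutative ring: exactly one of [x],
    [-x] lies in [s] whenever [x <> 0].  The relation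
      [f x y = s (x + y) (+) s (x - y)]
    on [s] is antisymmetric and unaffected by changing the sign of [x] or [y],
    so that the sign of gamma, computed as the parity of the number of pairs on
    which gamma disagrees with [f], only involves the even function
    [g z = s (a z) (+) s z] at [x + y] and [x - y].  Counting pairs with a given
    sum or difference shows that [g] is hit [h - 1] times at each element of
    [s], with [h = (n - 1) / 2]; hence the sign is [(-1) ^ ((h - 1) mu)], where
    [mu] is the number of [x] in [s] with [g x].

    It remains to see that [(-1) ^ mu] is the Jacobi symbol.  The parity of [mu]
    does not depend on the half-system, and a half-system of Z/mn that looks
    first at the residue modulo [m] makes it multiplicative in the modulus; for
    a prime modulus the claim is Gauss's lemma together with Euler's criterion.
    As [2 mu] is the sum of [g] over the whole ring, all counts are taken there
    and compared modulo 4. *)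

(** * The sign of a permutation as disagreement with an antisymmetric relation *)

Section DisagreementParity.
Variables (T : finType) (f : rel T).
Hypothesis fC : forall x y, x != y -> f y x = ~~ f x y.

(** [f] selects one ordering of each pair, and both orderings contribute equally. *)
Lemma sum_sym_pairs (c : T -> T -> int) :
    (forall x y, c x y = c y x) ->
  exists k, \sum_x \sum_(y | y != x) c x y = 2 * k.
Proof.
move=> cC; exists (\sum_x \sum_(y | (y != x) && f x y) c x y).
rewrite mulr_natl mulr2n.
under eq_bigr => x _ do rewrite (bigID (f x)) /=.
rewrite big_split /=; congr (_ + _).
rewrite (exchange_big_dep xpredT) //=; apply: eq_bigr => y _.
apply: eq_big => [x|x _]; last exact: cC.
by rewrite eq_sym; case: eqVneq => //= ?; rewrite fC ?negbK // eq_sym.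
Qed.

(** Ordered pairs are counted: for a strict linear order [f] this is twice the number of
    inversions. *)
Definition disagreement (s : {perm T}) : int :=
  \sum_x \sum_(y | y != x) (f (s x) (s y) (+) f x y)%:Z.

Let dis_sym (s : {perm T}) x y :
  y != x -> f (s x) (s y) (+) f x y = f (s y) (s x) (+) f y x.
Proof.
move=> yx; have xy : x != y by rewrite eq_sym.
by rewrite (fC xy) (@fC (s x) (s y)) ?(inj_eq perm_inj) // addNb addbN negbK.
Qed.

(** A xor is the sum of its bits minus twice their product. The products [c] are symmetric in [x]
    and [y], so the correction is a multiple of 4. *)
Let disM (s t : {perm T}) :
  exists k, disagreement (s * t)%g = disagreement s + disagreement t + 4 * k.
Proof.
pose c x y := if x == y then 0 else
  (f (t (s x)) (t (s y)) (+) f (s x) (s y))%:Z * (f (s x) (s y) (+) f x y)%:Z.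
have cC x y : c x y = c y x.
  rewrite /c eq_sym; case: eqVneq => // yx.
  by rewrite dis_sym ?(inj_eq perm_inj) // (dis_sym s).
have [k Ek] := sum_sym_pairs cC; exists (- k).
have -> : disagreement t = \sum_x \sum_(y | y != x)
    (f (t (s x)) (t (s y)) (+) f (s x) (s y))%:Z.
  rewrite /disagreement (reindex_inj (@perm_inj _ s)); apply: eq_bigr => x _.
  rewrite (reindex_inj (@perm_inj _ s)); apply: eq_bigl => y.
  by rewrite (inj_eq perm_inj).
have -> : 4 * - k = - 2 * \sum_x \sum_(y | y != x) c x y by rewrite Ek; ring.
rewrite /disagreement -big_split mulr_sumr -big_split /=; apply: eq_bigr => x _.
rewrite -big_split mulr_sumr -big_split /=; apply: eq_bigr => y yx.
rewrite /c eq_sym (negPf yx) !permM.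
by case: (f _ _); case: (f _ _); case: (f _ _).
Qed.

(** The pair [u], [v] counts 2. For any other [z], the pairs of [z] with [u] and with [v] disagree
    together, giving 0 or 4. Pairs avoiding [u] and [v] are fixed. *)
Let dis_tperm u v : u != v -> exists k, disagreement (tperm u v) = 2 + 4 * k.
Proof.
move=> uv; have vu : v != u by rewrite eq_sym.
pose c x y : int := (f (tperm u v x) (tperm u v y) (+) f x y)%:Z.
have cC x y : y != x -> c x y = c y x by move=> yx; rewrite /c (dis_sym _ yx).
have cuv : c u v = 1 by rewrite /c tpermL tpermR (fC uv); case: (f u v).
have cz z : z != u -> z != v -> c v z = c u z.
  by move=> zu zv; rewrite /c tpermL tpermR tpermD 1?eq_sym // addbC.
exists (\sum_(z | (z != u) && (z != v)) c u z).
have -> : disagreement (tperm u v) = \sum_x \sum_(y | y != x) c x y by [].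
rewrite (bigD1 u) //= [X in _ + X](bigD1 v) //= [X in X + _](bigD1 v) //=.
rewrite [X in _ + (X + _)](bigD1 u) //= (cC v u) // cuv.
have -> : \sum_(z | (z != v) && (z != u)) c v z
        = \sum_(z | (z != u) && (z != v)) c u z.
  by apply: eq_big => [z|z /andP[zv zu]]; [rewrite andbC | apply: cz].
have -> : \sum_(x | (x != u) && (x != v)) \sum_(y | y != x) c x y
        = \sum_(z | (z != u) && (z != v)) (2 * c u z).
  apply: eq_bigr => z /andP[zu zv].
  rewrite (bigD1 u) 1?eq_sym //= (bigD1 v) /=; last by rewrite eq_sym zv.
  rewrite big1 => [|y /andP[/andP[yz yu] yv]].
    by rewrite !(cC z) 1?eq_sym // cz //; ring.
  by rewrite /c !tpermD 1?eq_sym // addbb.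
rewrite -mulr_sumr; ring.
Qed.

Lemma disagreement_perm (s : {perm T}) :
  exists k, disagreement s = 2 * s%:Z + 4 * k.
Proof.
have [ts -> dts] := prod_tpermP s; elim: ts dts => [_|[u v] ts IH /= /andP[uv /IH[k Ek]]].
  rewrite big_nil; exists 0; rewrite odd_perm1 /disagreement big1 // => x _.
  by rewrite big1 // => y _; rewrite !perm1 addbb.
rewrite big_cons /=; have [l ->] := disM (tperm u v) (\prod_(i <- ts) tperm i.1 i.2)%g.
have [l' ->] := dis_tperm uv; rewrite Ek odd_permM odd_tperm uv.
case: (odd_perm _); [exists (l + l' + k + 1)|exists (l + l' + k)]; rewrite /=; ring.
Qed.

End DisagreementParity.

(** * Half-systems, their flips and Gauss's lemma *)

Section HalfSystem.
Variable R : finComUnitRingType.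
Implicit Types (s : pred R) (a x y : R).

Definition half_system s := ~~ s 0 /\ forall x, x != 0 -> s (- x) = ~~ s x.

Definition flip s a x := s (a * x) (+) s x.

Definition flips s a : int := \sum_x (flip s a x)%:Z.

Lemma mulUr_eq0 a x : a \is a GRing.unit -> (a * x == 0) = (x == 0).
Proof.
move=> ua; apply/eqP/eqP => [ax0|->]; last by rewrite mulr0.
by apply: (mulrI ua); rewrite ax0 mulr0.
Qed.

Section OneSystem.
Variables (s : pred R) (a : R).
Hypotheses (hs : half_system s) (ua : a \is a GRing.unit).

Let s0 : s 0 = false. Proof. by case: hs => /negPf. Qed.
Let sN x : x != 0 -> s (- x) = ~~ s x. Proof. by case: hs => _; apply. Qed.

Lemma half_neq0 x : s x -> x != 0.
Proof. by apply: contraTneq => ->; rewrite s0. Qed.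

Lemma half_addr_neq0 x y : s x -> s y -> x + y != 0.
Proof.
move=> sx sy; rewrite addr_eq0; apply: contraTneq sx => ->.
by rewrite sN ?half_neq0 // sy.
Qed.

Lemma sum_half (F : R -> int) :
  \sum_x F x = F 0 + \sum_(x | s x) (F x + F (- x)).
Proof.
rewrite (bigD1 0) //= (bigID s) /= big_split; congr (_ + (_ + _)) => /=.
  by apply: eq_bigl => x; case: eqVneq => // ->; rewrite s0.
rewrite (reindex_inj oppr_inj) /=; apply: eq_bigl => x.
by rewrite oppr_eq0; case: eqVneq => [->|/sN ->]; rewrite ?s0 ?negbK.
Qed.

Lemma sum_half_even (F : R -> int) : F 0 = 0 -> (forall x, F (- x) = F x) ->
  \sum_x F x = 2 * \sum_(x | s x) F x.
Proof.
move=> F0 FN; rewrite sum_half F0 add0r mulr_sumr; apply: eq_bigr => x _.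
by rewrite FN mulr_natl mulr2n.
Qed.

Lemma flip0 : flip s a 0 = false.
Proof. by rewrite /flip mulr0 addbb. Qed.

Lemma flipN x : flip s a (- x) = flip s a x.
Proof.
have [->|x0] := eqVneq x 0; first by rewrite oppr0.
by rewrite /flip mulrN !sN ?mulUr_eq0 // addNb addbN negbK.
Qed.

Lemma flips_half : flips s a = 2 * \sum_(x | s x) (flip s a x)%:Z.
Proof. by apply: sum_half_even => [|x]; rewrite ?flip0 ?flipN. Qed.

(** Of [a * x] and its opposite, the one on the same side of [s] as [x]; on the low residues this is
    gamma. *)
Definition twist x := (-1) ^+ flip s a x * (a * x).

Lemma half_twist x : s (twist x) = s x.
Proof.
rewrite /twist; have [->|x0] := eqVneq x 0; first by rewrite !mulr0.
have sNax : s (- (a * x)) = ~~ s (a * x) by rewrite sN ?mulUr_eq0.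
by rewrite /flip; case Eax: (s (a * x)); case: (s x);
   rewrite /= ?mul1r ?mulN1r ?sNax Eax.
Qed.

(** Equal twists force [x = y] or [x = - y], and the latter changes sides of [s] unless [y = 0]. *)
Lemma twist_inj : injective twist.
Proof.
have twistE x y : twist x = twist y -> x = y \/ x = - y.
  rewrite /twist; case: (flip s a x); case: (flip s a y);
    rewrite /= ?expr1 ?expr0 ?mulN1r ?mul1r -?mulrN => /(mulrI ua); try by left.
  - by move/oppr_inj; left.
  - by move=> <-; rewrite opprK; right.
  - by move=> ->; right.
move=> x y Exy; have := half_twist x; rewrite Exy half_twist.
have [-> //|->] := twistE _ _ Exy.
have [->|y0] := eqVneq y 0; first by rewrite oppr0.
by rewrite sN //; case: (s y).
Qed.

(* Gauss's lemma: twisting permutes the half-system. *)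
Lemma gauss_half : \prod_(x | s x) x \is a GRing.unit ->
  a ^+ #|s| = \prod_(x | s x) (-1) ^+ flip s a x.
Proof.
move=> uP; apply: (mulIr uP).
have -> : \prod_(x | s x) (-1) ^+ flip s a x * \prod_(x | s x) x =
   \prod_(x | s x) (-1) ^+ flip s a x * \prod_(x | s x) twist x.
  congr (_ * _); rewrite (reindex_inj twist_inj) /=.
  by apply: eq_bigl => x; rewrite half_twist.
rewrite -big_split /= -prodr_const -big_split /=; apply: eq_bigr => x _.
by rewrite /twist !mulrA -signr_addb addbb mul1r.
Qed.

End OneSystem.

(** [flip s' a x] is the xor of [flip s a x], [t (a * x)] and [t x], where [t] is invariant under
    negation. The two sums of [t] coincide and are even; the products [F] also have an even sum.
    Hence every correction is a multiple of 4. *)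
Lemma flips_indep s s' a : half_system s -> half_system s' ->
  a \is a GRing.unit -> exists k, flips s' a = flips s a + 4 * k.
Proof.
move=> hs hs' ua.
pose t x : bool := s x (+) s' x.
have t0 : t 0 = false by rewrite /t; case: hs => /negPf-> _; case: hs' => /negPf->.
have tN x : t (- x) = t x.
  have [->|x0] := eqVneq x 0; first by rewrite oppr0.
  by rewrite /t; case: hs => _ ->; case: hs' => // _ -> //; rewrite addNb addbN negbK.
have E x : (flip s' a x)%:Z = (flip s a x)%:Z + (t (a * x))%:Z + (t x)%:Z
    - 2 * ((t (a * x))%:Z * (t x)%:Z + (flip s a x)%:Z * (t (a * x) (+) t x)%:Z).
  rewrite /flip /t.
  by case: (s _); case: (s' _); case: (s _); case: (s' _).
pose F x : int := (t (a * x))%:Z * (t x)%:Z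
  + (flip s a x)%:Z * (t (a * x) (+) t x)%:Z.
have EF : \sum_x F x = 2 * \sum_(x | s x) F x.
  apply: (sum_half_even hs) => [|x]; rewrite /F; first by rewrite flip0 t0 mulr0.
  by rewrite mulrN !tN flipN.
have Et : \sum_x (t x)%:Z = 2 * \sum_(x | s x) (t x)%:Z.
  by apply: (sum_half_even hs) => [|x]; rewrite ?t0 ?tN.
have Eta : \sum_x (t (a * x))%:Z = \sum_x (t x)%:Z.
  by rewrite [RHS](reindex_inj (mulrI ua)).
exists (\sum_(x | s x) (t x)%:Z - \sum_(x | s x) F x).
rewrite /flips (eq_bigr _ (fun x _ => E x)).
rewrite big_split /= sumrN -mulr_sumr -/(F _) EF !big_split /= Eta Et; ring.
Qed.

End HalfSystem.

(** * The sign of the twist on a half-system *)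

Section TwistSign.
Variables (R : finComUnitRingType) (s : pred R) (a : R) (T : finType) (h : T -> R).
Hypotheses (hs : half_system s) (ua : a \is a GRing.unit).
Hypothesis u2 : (2 : R) \is a GRing.unit.
Hypotheses (s_h : forall t, s (h t)) (h_bij : {on s, bijective h}).
Variable sigma : {perm T}.
Hypothesis h_sigma : forall t, h (sigma t) = twist s a (h t).

Let h_inj : injective h.
Proof. by case: h_bij => g hK _ t t' E; rewrite -[t]hK ?E ?hK; try exact: s_h. Qed.

(* Antisymmetric, and invariant under the sign changes of both arguments, so
   it turns the permutation into plain multiplication by a. *)
Let f t t' := s (h t + h t') (+) s (h t - h t').

Let subr_h_neq0 t t' : t != t' -> h t - h t' != 0.
Proof. by rewrite subr_eq0 (inj_eq h_inj). Qed.

Let fC t t' : t != t' -> f t' t = ~~ f t t'.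
Proof.
move=> /subr_h_neq0 tt'; case: (hs) => _ sN.
by rewrite /f -[h t' - h t]opprB sN // addrC addbN.
Qed.

Let f_sigma t t' : t != t' ->
  f (sigma t) (sigma t') = s (a * (h t + h t')) (+) s (a * (h t - h t')).
Proof.
move=> tt'; case: (hs) => _ sN.
have sND : s (- (a * (h t + h t'))) = ~~ s (a * (h t + h t')).
  by rewrite sN // mulUr_eq0 // (half_addr_neq0 hs).
have sNB : s (- (a * (h t - h t'))) = ~~ s (a * (h t - h t')).
  by rewrite sN // mulUr_eq0 // subr_h_neq0.
rewrite /f !h_sigma /twist; move: (h t) (h t') sND sNB => x y sND sNB.
have eD : a * x + a * y = a * (x + y) by ring.
have eB : a * x - a * y = a * (x - y) by ring.
have eNB : - (a * x) + a * y = - (a * (x - y)) by ring.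
have eND : - (a * x) - a * y = - (a * (x + y)) by ring.
(* Different twisting signs exchange sum and difference; the negations, none or two, cancel in the
   xor. *)
case: (flip s a _); case: (flip s a _);
  rewrite /= ?expr0 ?expr1 ?mulN1r ?mul1r ?opprK ?eD ?eB ?eNB ?eND ?sND ?sNB //.
- by rewrite addNb addbN negbK.
- by rewrite addNb addbN negbK addbC.
- by rewrite addbC.
Qed.

Lemma twist_perm_sign :
  exists k, 2 * sigma%:Z = (#|T|%:Z - 1) * flips s a + 4 * k.
Proof.
pose g x : int := (flip s a x)%:Z.
have gN x : g (- x) = g x by rewrite /g flipN.
have g0 : g 0 = 0 by rewrite /g flip0.
have sumT (F : R -> int) : \sum_t F (h t) = \sum_(x | s x) F x.
  by rewrite [RHS](reindex h) //; apply: eq_bigl => t; rewrite s_h.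
pose c t t' := g (h t + h t') * g (h t - h t').
have [k1 E1] := disagreement_perm fC sigma.
have [k2 E2] : exists k, \sum_t \sum_(t' | t' != t) c t t' = 2 * k.
  apply: (sum_sym_pairs fC) => t t'.
  by rewrite /c addrC -[g (h t - _)]gN opprB.
(* The disagreement at a pair is the xor of [g] at sum and difference; the product term is
   symmetric, so it vanishes modulo 4. *)
have E3 : disagreement f sigma + 2 * \sum_t \sum_(t' | t' != t) c t t' =
    \sum_t \sum_(t' | t' != t) (g (h t + h t') + g (h t - h t')).
  rewrite mulr_sumr -big_split; apply: eq_bigr => t _ /=.
  rewrite mulr_sumr -big_split; apply: eq_bigr => t' tt' /=.
  rewrite f_sigma 1?eq_sym // /f /c /g /flip.
  by case: (s _); case: (s _); case: (s _); case: (s _).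
(* Over all [t'], the elements [h t + h t'] and [h t - h t'] cover the ring except [h t]. Omitting
   [t' = t] removes [2 * h t] and [0], where [g] vanishes. *)
have E4 t : \sum_(t' | t' != t) (g (h t + h t') + g (h t - h t')) =
    flips s a - g (h t) - g (2 * h t).
  have -> : flips s a = \sum_y g (h t + y).
    by rewrite /flips (reindex_inj (addrI (h t))).
  rewrite (sum_half hs) addr0 -(sumT (fun y => g (h t + y) + g (h t - y))).
  by rewrite [in RHS](bigD1 t) //= subrr g0 -mulr2n -[h t *+ 2]mulr_natl; ring.
(* Doubling permutes the ring and [g] ignores signs. The two subtracted sums thus make up one
   [flips s a], whence the factor [#|T| - 1]. *)
have E5 : \sum_t g (2 * h t) = \sum_t g (h t).
  rewrite (sumT (fun x => g (2 * x))) (sumT g).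
  have : \sum_x g (2 * x) = \sum_x g x by rewrite [RHS](reindex_inj (mulrI u2)).
  rewrite !(sum_half_even hs) ?mulr0 // => [/(mulfI _)-> //|x].
  by rewrite mulrN.
have E6 := flips_half hs ua; rewrite -/(g _) -(sumT g) in E6.
move: E3; under [RHS]eq_bigr do rewrite E4.
rewrite !big_split /= !sumrN sumr_const -/g E5 E2 E1 E6 => E3.
exists (- k1 - k2).
have -> : 2 * sigma%:Z = (2 * sigma%:Z + 4 * k1 + 2 * (2 * k2)) - 4 * k1 - 4 * k2 by ring.
rewrite E3 -mulr_natl natz; ring.
Qed.

End TwistSign.

(** * Finite fields: Gauss's lemma and Euler's criterion *)

Section FieldHalfSystem.
Variables (F : finFieldType) (s : pred F) (a : F).
Hypotheses (hs : half_system s) (a_neq0 : a != 0).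

Lemma gauss_half_field :
  a ^+ #|s| = (-1) ^+ (\sum_(x | s x) flip s a x)%N.
Proof.
rewrite (gauss_half hs) ?unitfE //; last first.
  by apply/prodf_neq0 => x /(half_neq0 hs).
by rewrite prodrXr.
Qed.

(** Characteristic 2 admits no half-system, so a sign can be read off from its value in [F]. *)
Lemma half_oppr1_neq1 : -1 != 1 :> F.
Proof.
apply/eqP => E; case: hs => _ /(_ 1 (oner_neq0 F)).
by rewrite E; case: (s 1).
Qed.
End FieldHalfSystem.

(* Euler's criterion: the squares of the half-system already exhaust the roots
   of 'X^h - 1, where h is its size. *)
Lemma euler_half (F : finFieldType) (s : pred F) (a : F) :
    half_system s -> a != 0 ->
  (a ^+ #|s| == 1) = [exists x, x ^+ 2 == a].
Proof.
move=> hs a0.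
have sq1 (x : F) : x != 0 -> (x ^+ 2) ^+ #|s| = 1.
  by move=> x0; rewrite exprAC (gauss_half_field hs) // sqrr_sign.
apply/idP/existsP => [/eqP ah|[x /eqP E]]; last first.
  by rewrite -E sq1 //; apply: contra_neq a0 => x0; rewrite -E x0 expr0n.
apply/existsP/contraT; rewrite negb_exists => /forallP nsq.
(* A nonsquare [a] would join the distinct squares of [s] as one root too many. *)
pose rs := a :: [seq x ^+ 2 | x <- enum s].
have h0 : (0 < #|s|)%N.
  apply/card_gt0P; case: (boolP (s 1)) => s1; first by exists 1.
  by exists (-1); rewrite unfold_in; case: hs => _ -> //; rewrite oner_neq0.
have szp : size ('X^#|s| - 1 : {poly F}) = #|s|.+1.
  by rewrite size_XnsubC.
have : (size rs < size ('X^#|s| - 1 : {poly F})%R)%N.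
  apply: max_poly_roots.
  - by rewrite -size_poly_eq0 szp.
  - rewrite /= /root !hornerE ?hornerXn ah subrr eqxx /=.
    apply/allP => y /mapP[x]; rewrite mem_enum => sx ->.
    by rewrite /root !hornerE ?hornerXn sq1 ?subrr // (half_neq0 hs).
  rewrite /= map_inj_in_uniq ?enum_uniq ?andbT.
    by apply/negP => /mapP[x _ E]; have := nsq x; rewrite E eqxx.
  move=> x y; rewrite !mem_enum => sx sy /eqP.
  rewrite eqf_sqr => /orP[/eqP //|]; rewrite -addr_eq0.
  by rewrite (negPf (half_addr_neq0 hs sx sy)).
by rewrite szp /= size_map -cardE ltnn.
Qed.

(** * Half-systems of residues, and prime moduli *)

(** Predicates on [nat] let a modulus be factored or rewritten without casts between the types
    ['I_N]. *)
Definition nat_half_system N (s : pred nat) :=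
  ~~ s 0%N /\ forall x, (0 < x < N)%N -> s (N - x)%N = ~~ s x.

Definition nat_flip N (s : pred nat) (a x : nat) := s ((a * x) %% N)%N (+) s x.

Definition nat_flips N s a : int := \sum_(0 <= x < N) (nat_flip N s a x)%:Z.

Definition low N x := (0 < x <= (N - 1) %/ 2)%N.

Lemma nat_half_system_ord m s : nat_half_system m.+2 s ->
  half_system (fun x : 'I_m.+2 => s x).
Proof.
case=> s0 sN; split=> // x x0; rewrite -sN.
  by rewrite /= modn_small // ltn_subrL lt0n andbT.
by rewrite lt0n ltn_ord andbT.
Qed.

Lemma nat_flips_ord m (s : pred nat) a :
  flips (fun x : 'I_m.+2 => s x) a%:R = nat_flips m.+2 s a.
Proof.
rewrite /flips /nat_flips big_mkord; apply: eq_bigr => x _.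
by rewrite /flip /nat_flip Zp_nat /= modnMml.
Qed.

Lemma low_half_system N : odd N -> nat_half_system N (low N).
Proof. by move=> oN; split=> // x; rewrite /low; lia. Qed.

Lemma nat_flips_even N a : odd N -> (1 < N)%N -> coprime a N ->
  exists k, nat_flips N (low N) a = 2 * k.
Proof.
case: N => [|[|m]] // oN _ co.
rewrite -nat_flips_ord flips_half; last by rewrite (@unitZpE m.+2) // coprime_sym.
  by eexists.
exact/nat_half_system_ord/low_half_system.
Qed.

Lemma legendre_exists (p a : nat) : prime p -> coprime a p ->
  legendre a%:Z p = if [exists x : 'F_p, x ^+ 2 == a%:R] then 1 else -1.
Proof.
move=> pp co; rewrite /legendre.
have -> : (p%:Z %| a%:Z)%Z = false.
  by rewrite /dvdz !absz_nat; apply/negbTE; rewrite -prime_coprime // coprime_sym.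
congr (if _ then _ else _).
have eqF (x : nat) :
    (x%:Z ^+ 2 == a%:Z %[mod p%:Z])%Z = (x%:R ^+ 2 == a%:R :> 'F_p).
  rewrite expr2 -PoszM !modz_nat eqz_nat expr2 -natrM -val_eqE /=.
  by rewrite !val_Fp_nat.
have ltF (x : 'F_p) : (x < p)%N by rewrite -{2}(Fp_cast pp).
apply/existsP/existsP => [[x xa]|[y ya]].
  by exists (x : nat)%:R; rewrite -eqF.
by exists (Ordinal (ltF y)); rewrite eqF /= (natr_Zp y).
Qed.

(** The flips number [2 * mu], which is [1 - (-1) ^+ mu] modulo 4; by Gauss and Euler this sign is
    the Legendre symbol. *)
Lemma nat_flips_prime p a : prime p -> odd p -> coprime a p ->
  exists k, nat_flips p (low p) a = 1 - legendre a%:Z p + 4 * k.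
Proof.
move=> pp op co; rewrite legendre_exists //.
have hs : half_system (fun x : 'F_p => low p x).
  by apply: nat_half_system_ord; rewrite Fp_cast //; apply: low_half_system.
rewrite -[X in nat_flips X](Fp_cast pp) -nat_flips_ord.
have a0 : (a%:R : 'F_p) != 0 by rewrite -unitfE unitFpE // coprime_sym.
rewrite (flips_half hs) -?unitfE ?unitFpE // 1?coprime_sym //.
rewrite -(@euler_half 'F_p _ _ hs a0) (@gauss_half_field 'F_p _ _ hs a0).
set mu := (\sum_(x | _) _)%N.
have -> : \sum_(x : 'F_p | low p x)
   (flip (fun x : 'F_p => low p x) a%:R x)%:Z = mu%:Z.
  by rewrite /mu -!natz natr_sum; apply: eq_bigr => x _; rewrite natz.
have -> : ((-1) ^+ mu == 1 :> 'F_p) = ~~ odd mu.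
  rewrite -signr_odd; case: (odd mu) => /=; last by rewrite eqxx.
  by rewrite (negPf (@half_oppr1_neq1 'F_p _ hs)).
rewrite -{1}(odd_double_half mu) if_neg.
case: (odd mu); exists (mu./2)%:Z; lia.
Qed.

(** * Multiplicativity in the modulus *)

(** The multiples of [m] form a copy of the residues modulo [n], on which the quotient decides. *)
Definition lex_low m n x :=
  if (m %| x)%N then low n (x %/ m)%N else low m (x %% m)%N.

Lemma lex_low_half_system m n : odd m -> odd n ->
  nat_half_system (n * m) (lex_low m n).
Proof.
move=> om on; have m0 : (0 < m)%N by case: m om.
split=> [|x /andP[x0 xN]]; first by rewrite /lex_low dvdn0 div0n.
rewrite /lex_low dvdn_subr ?dvdn_mull ?(ltnW xN) //.
case: (boolP (m %| x)%N) => [/dvdnP[k E]|ndv].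
  rewrite E -mulnBl !mulnK //; case: (low_half_system on) => _ -> //.
  by move: x0 xN; rewrite E muln_gt0 ltn_mul2r => /andP[-> _] /andP[].
have r0 : (0 < x %% m)%N by rewrite lt0n -/(dvdn _ _).
have rm := ltn_pmod x m0.
have -> : ((n * m - x) %% m = m - x %% m)%N.
  have q : (x %/ m < n)%N by rewrite ltn_divLR.
  have -> : (n * m - x = (n - (x %/ m).+1) * m + (m - x %% m))%N.
    have := divn_eq x m; nia.
  by rewrite modnMDl modn_small // ltn_subrL r0.
by case: (low_half_system om) => _ -> //; rewrite r0.
Qed.

(** Write [x = y + i * m]. For [y != 0] the flip depends on [y] alone and recurs for all [n] values
    of [i]; for [y = 0] it is the flip of [i] modulo [n]. *)
Lemma nat_flips_lex m n a : odd m -> odd n -> coprime a m ->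
  nat_flips (n * m) (lex_low m n) a =
  n%:Z * nat_flips m (low m) a + nat_flips n (low n) a.
Proof.
move=> om on co; have m0 : (0 < m)%N by case: m om {co}.
pose t N x : int := (nat_flip N (low N) a x)%:Z.
have E i y : (y < m)%N -> (nat_flip (n * m) (lex_low m n) a (y + i * m))%:Z
    = t m y + (if y == 0%N then t n i else 0).
  move=> ym; rewrite /t /nat_flip /lex_low.
  have r : ((y + i * m) %% m = y)%N by rewrite addnC modnMDl modn_small.
  have -> : (m %| (a * (y + i * m)) %% (n * m) = (y == 0))%N.
    rewrite /dvdn modn_dvdm ?dvdn_mull // -/(dvdn _ _).
    by rewrite Gauss_dvdr 1?coprime_sym // /dvdn r.
  have -> : (m %| (y + i * m) = (y == 0))%N by rewrite /dvdn r.
  case: eqVneq => [->|y0]; last first.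
    by rewrite addr0 modn_dvdm ?dvdn_mull // -modnMmr r.
  by rewrite !add0n muln0 mod0n addbb add0r mulnA -muln_modl !mulnK.
rewrite /nat_flips big_nat_mul.
have -> : n%:Z * \sum_(0 <= x < m) (nat_flip m (low m) a x)%:Z =
  \sum_(0 <= i < n) \sum_(0 <= x < m) t m x.
  by rewrite sumr_const_nat subn0 -mulr_natl natz.
rewrite -big_split; apply: eq_bigr => i _ /=.
rewrite -{1}[(i * m)%N]add0n big_addn mulSn addnK big_nat.
under eq_bigr => y /andP[_ ym] do rewrite E //.
rewrite -big_nat big_split; congr (_ + _).
by rewrite big_ltn //= big1_seq ?addr0 // => y; rewrite mem_index_iota => /andP[_]; case: y.
Qed.

Lemma nat_flips_mul m n a : odd m -> (1 < m)%N -> odd n -> coprime a (n * m) ->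
  exists k, nat_flips (n * m) (low (n * m)) a =
            nat_flips m (low m) a + nat_flips n (low n) a + 4 * k.
Proof.
move=> om m1 on co.
have com : coprime a m by move: co; rewrite coprimeMr => /andP[].
have [k1 E1] : exists k, nat_flips (n * m) (low (n * m)) a =
    nat_flips (n * m) (lex_low m n) a + 4 * k.
  have oN : odd (n * m) by rewrite oddM on.
  have N1 : (1 < n * m)%N by case: n on {co oN} => // n' _; nia.
  have := lex_low_half_system om on; have := low_half_system oN.
  move: N1 co; case: (n * m)%N (lex_low m n) => [|[|N]] // s _ co h1 h2.
  rewrite -!nat_flips_ord; apply: flips_indep; try exact: nat_half_system_ord.
  by rewrite (@unitZpE N.+2) // coprime_sym.
(* As [n] is odd and the count modulo [m] is even, the factor [n] disappears modulo 4. *)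
have [k2 E2] := nat_flips_even om m1 com.
rewrite E1 nat_flips_lex // E2 -{1}(odd_double_half n) on.
exists (k1 + (n./2)%:Z * k2); rewrite -mul2n; lia.
Qed.

(** * The Jacobi symbol *)

Lemma jacobi1 a : jacobi a 1 = 1.
Proof. by rewrite /jacobi big_nil. Qed.

(** A common range of primes, with exponent 0 at nondivisors, lets different moduli be compared
    factor by factor. *)
Lemma jacobi_wide (a : int) n N : (0 < n < N)%N ->
  jacobi a n = \prod_(0 <= p < N | prime p) legendre a p ^+ logn p n.
Proof.
case/andP => n0 nN; rewrite /jacobi.
rewrite [RHS](bigID (fun p => p \in primes n)) /= [X in _ * X]big1 ?mulr1.
  rewrite -[RHS]big_filter; apply: perm_big; apply: uniq_perm.
  - exact: primes_uniq.
  - by rewrite filter_uniq ?iota_uniq.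
  move=> p; rewrite mem_filter mem_index_iota /=.
  case: (boolP (p \in primes n)) => pn; last by rewrite andbF.
  have := pn; rewrite mem_primes => /and3P[-> _ /(dvdn_leq n0) le].
  by rewrite (leq_ltn_trans le nN).
by move=> p /andP[pp]; rewrite -logn_gt0 lt0n negbK => /eqP ->.
Qed.

Lemma jacobiM a m n : (0 < m)%N -> (0 < n)%N ->
  jacobi a (m * n) = jacobi a m * jacobi a n.
Proof.
move=> m0 n0; rewrite !(@jacobi_wide _ _ (m * n).+1) ?muln_gt0 ?m0 ?n0 ?ltnS //=.
- by rewrite -big_split; apply: eq_bigr => p _; rewrite lognM // exprD.
- by rewrite leq_pmull.
- by rewrite leq_pmulr.
Qed.

Lemma jacobi_prime a p : prime p -> jacobi a p = legendre a p.
Proof.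
by move=> pp; rewrite /jacobi primes_prime // big_seq1 logn_prime // eqxx.
Qed.

(* Schering's generalisation of Gauss's lemma to the Jacobi symbol. *)
Lemma nat_flips_jacobi N a : odd N -> coprime a N ->
  (exists k, nat_flips N (low N) a = 1 - jacobi a%:Z N + 4 * k)
  /\ (jacobi a%:Z N = 1 \/ jacobi a%:Z N = -1).
Proof.
elim/ltn_ind: N => N IH oN co.
have [N1|N1] := leqP N 1.
  have -> : N = 1%N by case: N N1 oN {IH co} => [|[]].
  rewrite jacobi1; split; last by left.
  by exists 0; rewrite /nat_flips big_nat1 /nat_flip muln0.
have pp := pdiv_prime N1; have /dvdnP[n E] := pdiv_dvd N.
move: (pdiv N) pp E => p pp E; subst N.
have n0 : (0 < n)%N by case: n oN {IH co N1}.
move: (oN) (co); rewrite oddM coprimeMr => /andP[on op] /andP[con cop].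
have nN : (n < n * p)%N by rewrite ltn_Pmulr ?prime_gt1.
have [[k1 E1] J1] := IH n nN on con.
have [k2 E2] := nat_flips_prime pp op cop.
have [k3 ->] := nat_flips_mul op (prime_gt1 pp) on co.
rewrite jacobiM ?(prime_gt0 pp) // (jacobi_prime _ pp) E1 E2.
have : legendre a%:Z p = 1 \/ legendre a%:Z p = -1.
  by rewrite legendre_exists //; case: ifP; [left|right].
(* For signs [e] and [e'], [(1 - e) + (1 - e')] exceeds [1 - e * e'] by [(1 - e) * (1 - e')], which
   is 0 or 4. *)
case: J1 => ->; case=> ->; split; try by [left|right].
- by exists (k1 + k2 + k3); lia.
- by exists (k1 + k2 + k3); lia.
- by exists (k1 + k2 + k3); lia.
- by exists (k1 + k2 + k3 + 1); lia.
Qed.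

Lemma jacobi_mod (a b : int) n : (a = b %[mod n%:Z])%Z -> jacobi a n = jacobi b n.
Proof.
move=> ab; rewrite /jacobi big_seq_cond [RHS]big_seq_cond; apply: eq_bigr => p.
rewrite mem_primes andbT => /and3P[_ _ pn]; congr (_ ^+ _).
have abp : (a = b %[mod p%:Z])%Z.
  apply/eqP; rewrite eqz_mod_dvd; apply: (@dvdz_trans n%:Z) => //.
  by rewrite -eqz_mod_dvd ab.
rewrite /legendre abp; congr (if _ then _ else _).
by apply/dvdz_mod0P/dvdz_mod0P; rewrite abp.
Qed.

(** * Gamma as a twist, and its sign *)

Lemma half_range_perm n b : (1 < n)%N -> odd n -> coprime b n ->
  exists s : {perm half_range n},
    (forall x, half_val (s x) =
       let r := ((b * half_val x) %% n)%N in
       if ((n + 1) %/ 2 <= r)%N then (n - r)%N else r) /\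
    exists k, 2 * s%:Z = (((n - 1) %/ 2)%:Z - 1) * nat_flips n (low n) b + 4 * k.
Proof.
case: n => [|[|m]] // _; set n := m.+2 => on co.
pose s (x : 'I_n) := low n x.
have hs : half_system s by apply: nat_half_system_ord; apply: low_half_system.
have ub : (b%:R : 'I_n) \is a GRing.unit by rewrite (@unitZpE n) // coprime_sym.
have u2 : (2 : 'I_n) \is a GRing.unit by rewrite (@unitZpE n) // coprimen2.
pose h (t : half_range n) : 'I_n := val t.
have sh t : s (h t) by exact: (valP t).
have h_bij : {on s, bijective h}.
  pose d (x : 'I_n) (sx : s x) : half_range n := Sub x sx.
  (* Whichever of 1 and -1 lies in [s] is the default value of the inverse outside [s]. *)
  have s1 : s (if s 1 then 1 else -1).
    by case: ifPn => // s1; case: hs => _ -> //; rewrite oner_neq0.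
  exists (insubd (d _ s1)) => [t _|x sx]; first exact: valKd.
  by rewrite /h insubdK.
have st t : s (twist s b%:R (h t)) by rewrite half_twist.
pose g t : half_range n := Sub (twist s b%:R (h t)) (st t).
have g_inj : injective g.
  by move=> t t' /(congr1 val) /= /(twist_inj hs ub) /val_inj.
have hg t : h (perm g_inj t) = twist s b%:R (h t) by rewrite permE.
have bE (x : 'I_n) : (b%:R * x : 'I_n) = ((b * x) %% n)%N :> nat.
  by rewrite Zp_nat /= modnMml.
exists (perm g_inj); split.
  move=> t; rewrite /half_val -/(h _) hg -/(h t).
  have := sh t; have := mulUr_eq0 (h t) ub; have := half_neq0 hs (sh t).
  move: (h t) => x /negPf -> ax0 sx.
  have r0 : (0 < (b * x) %% n)%N by rewrite -bE lt0n; apply/negPf.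
  have rn : ((b * x) %% n < n)%N by rewrite ltn_pmod.
  rewrite /twist /flip sx addbT {1}/s bE.
  have -> : low n ((b * x) %% n) = ~~ ((n + 1) %/ 2 <= (b * x) %% n)%N.
    by rewrite /low; lia.
  rewrite negbK; case: (_ <= _)%N; last first.
    by rewrite expr0 mul1r; apply: bE.
  rewrite expr1 mulN1r.
  transitivity ((n - nat_of_ord (b%:R * x : 'I_n)%R) %% n)%N; first by [].
  by rewrite bE modn_small // ltn_subrL r0.
have [k E] := twist_perm_sign hs ub u2 sh h_bij hg.
exists k; rewrite E nat_flips_ord; congr ((_%:Z - 1) * _ + _).
(* Summing 1 over the ring gives [n = 1 + 2 * #|s|]. *)
have := sum_half hs (fun=> 1).
rewrite !sumr_const card_ord (_ : #|half_range n| = #|s|); last first.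
  by rewrite card_sig; apply: eq_card.
rewrite -[_ *+ #|s|]mulr_natr !natz -/n => En; lia.
Qed.

Theorem theorem1 (n : nat) (a : int)
    (n_ge3 : (3 <= n)%N) (n_odd : odd n) (co_an : gcdz a n%:Z = 1) :
  exists s : {perm half_range n},
    [/\ forall x : half_range n, (half_val (s x))%:Z = gamma a n (half_val x),
        (n = 1 %[mod 4])%N -> (-1) ^+ s = jacobi a n
      & (n = 3 %[mod 4])%N -> (-1) ^+ s = 1 :> int].
Proof.
have n_gt0 : (0 < n)%N by lia.
have n0 : n%:Z != 0 by lia.
pose b := `|(a %% n%:Z)%Z|%N.
have bE : b%:Z = (a %% n%:Z)%Z by rewrite /b gez0_abs // modz_ge0.
have ab : (a = b%:Z %[mod n%:Z])%Z by rewrite bE modz_mod.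
have co : coprime b n.
  rewrite /coprime -[n in gcdn _ n]absz_nat -eqz_nat -/(gcdz (a %% n%:Z)%Z n%:Z).
  by rewrite gcdz_modl co_an.
rewrite (jacobi_mod ab).
have [[k1 E1] J] := nat_flips_jacobi n_odd co.
have [s [sE [k2 E2]]] := half_range_perm (ltnW n_ge3) n_odd co.
exists s; split=> [x|n4|n4].
- rewrite /gamma -modzMml -bE -PoszM modz_nat lez_nat sE /=.
  by case: ifP => // _; rewrite subzn // ltnW // ltn_pmod.
(* The factor [(n - 1) / 2 - 1] is odd, so the sign is the Jacobi symbol. *)
- have h2 : ((n - 1) %/ 2 = 2 * (n %/ 4))%N by lia.
  by move: E2; rewrite E1 h2; case: J => ->; case: (s : bool) => /= E2 //; exfalso; lia.
(* Here that factor is even, and so is the flip count: the product vanishes modulo 4. *)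
have h2 : ((n - 1) %/ 2 = 2 * (n %/ 4) + 1)%N by lia.
by move: E2; rewrite E1 h2; case: J => ->; case: (s : bool) => /= E2 //; exfalso; lia.
Qed.
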